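(* Consider the noisy left-eigenvector estimation recursion and the scaling gains $\kappa_{i,k}$ defined in the context, under the network and noise assumptions stated there. Let $\Lambda_k=\sum_{t=0}^{k}\lambda_t$ and $\Gamma_k=\sum_{t=0}^{k}\gamma_t$. Suppose that $\{\lambda_k\}$ is nonincreasing with $\lambda_k\in(0,1]$ for all $k\ge0$, and that $\sum_{k=0}^\infty\lambda_k=\infty$, $\sum_{k=0}^\infty\gamma_k=\infty$, $\lim_{k\to\infty}\frac{1}{\Gamma_k}\sup_{0\le l\le k}\frac{\gamma_l}{\lambda_l}=0$ and $\lim_{k\to\infty}\frac{\Lambda_k}{\Gamma_k}=0$. Then, almost surely, $$\lim_{k\to\infty}\kappa_{i,k}=\frac{1}{n r_i}\qquad\text{for all } i\in\{1,\dots,n\}.$$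
   Context: Let $\mathcal V=\{1,\dots,n\}$ index agents. Network assumption: $W=[W_{ij}]\in\mathbb R^{n\times n}$ is a primitive nonnegative matrix with $W\mathbf 1=\mathbf 1$; here $W_{ij}\in(0,1)$ if $j=i$ or $j$ is an in-neighbor of $i$ in the communication digraph, and $W_{ij}=0$ otherwise. Let $\mathbf r=(r_1,\dots,r_n)^\top$ be the unique positive vector with $\mathbf r^\top W=\mathbf r^\top$ and $\mathbf r^\top\mathbf 1=1$. Recursion. Let $\{\lambda_k\},\{\gamma_k\}$ be positive (deterministic) gain sequences and $\varepsilon_\kappa>0$ a fixed constant. Initialize $\mathbf y_{i,0}\in\mathbb R^n$ as the $i$-th standard basis vector and $\kappa_{i,-1}=0$. For $k\ge0$ and $i\in\mathcal V$, $$\mathbf y_{i,k+1}=(1-\lambda_k)\mathbf y_{i,k}+\lambda_k\Big(\sum_{j=1}^nW_{ij}\mathbf y_{j,k}+\mathbf e^y_{i,k}\Big)+\gamma_k\mathbf y_{i,0},$$ $$\kappa_{i,k}=\frac{\sum_{j=1}^n[\mathbf y_{i,k+1}]_j}{n[\mathbf y_{i,k+1}]_i}\ \text{ if }[\mathbf y_{i,k+1}]_i>\varepsilon_\kappa,\qquad \kappa_{i,k}=\kappa_{i,k-1}\ \text{ otherwise}.$$ Noise assumption: the $\mathbb R^n$-valued random vectors $\mathbf e^y_{i,k}$ are mutually independent over all $i\in\mathcal V$, $k\ge0$, zero-mean, with variances uniformly bounded by a constant $\sigma>0$, and there is a constant $\tilde\sigma_y$ with $\|\mathbf e^y_{i,k}\|\le\tilde\sigma_y$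 for all $i,k$ almost surely. *)

(* Defs.v *)
From HB Require Import structures.
From mathcomp Require Import all_boot all_order all_algebra.
From mathcomp Require Import all_classical all_reals all_analysis.

Set Implicit Arguments.
Unset Strict Implicit.
Unset Printing Implicit Defensive.

Import Order.TTheory GRing.Theory Num.Theory.
Import numFieldNormedType.Exports.

Local Open Scope classical_set_scope.
Local Open Scope ring_scope.

Definition primitive_mx (R : realType) (n : nat) (W : 'M[R]_n) : Prop :=
  (forall i j, 0 <= W i j) /\
  exists2 m : nat, (0 < m)%N & forall i j, 0 < (W ^+ m) i j.

(* The library's norm on matrices is the sup norm, hence this one. *)
Definition enorm (R : realType) (n : nat) (v : 'rV[R]_n) : R :=
  Num.sqrt (\sum_(j < n) v 0 j ^+ 2).

(* 'rV[R]_n with its Borel sigma-algebra (its topology is the product one). *)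
Definition borel_rV (R : realType) (n : nat) :=
  g_sigma_algebraType (@open 'rV[R]_n).

Definition mutually_independent (d : measure_display) (T : measurableType d)
    (R : realType) (P : probability T R) (I : eqType)
    (d' : measure_display) (S : measurableType d') (X : I -> T -> S) : Prop :=
  forall (s : seq I) (B : I -> set S),
    uniq s -> (forall i, measurable (B i)) ->
    P (\big[setI/setT]_(i <- s) (X i @^-1` B i)) =
    (\prod_(i <- s) P (X i @^-1` B i))%E.

(* The variance of a random vector v is E|v - E v|^2, i.e. the sum of the
   variances of its components. *)
Definition vvariance (d : measure_display) (T : measurableType d)
    (R : realType) (P : probability T R) (n : nat) (v : T -> 'rV[R]_n)
    : \bar R :=
  (\sum_(j < n) 'V_P[fun w => (v w 0 j)%R])%E.

Section recursion.
Variables (R : realType) (n : nat) (W : 'M[R]_n).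
Variables (lambda gamma : nat -> R) (epsk : R).
(* [e i k] is the value of the noise vector of agent i at time k. *)
Variable e : 'I_n -> nat -> 'rV[R]_n.

Fixpoint eigvec_est (k : nat) (i : 'I_n) : 'rV[R]_n :=
  if k is k'.+1 then
    (1 - lambda k') *: eigvec_est k' i
    + lambda k' *: (\sum_(j < n) W i j *: eigvec_est k' j + e i k')
    + gamma k' *: delta_mx 0 i
  else delta_mx 0 i.

(* The gain at time k is computed from the estimate at time k.+1; the gain at
   time -1 is 0. *)
Fixpoint scaling_gain (k : nat) (i : 'I_n) : R :=
  let y := eigvec_est k.+1 i in
  if epsk < y 0 i then (\sum_(j < n) y 0 j) / (n%:R * y 0 i)
  else if k is k'.+1 then scaling_gain k' i else 0.

End recursion.

(* Main.v *)
(* The noise is bounded, so the argument is deterministic along almost every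
   path. Put the estimates in the rows of a matrix Y_k. Multiplying by r on the
   left gives r Y_{k+1} = (1 + Gamma_k) r + O(Lambda_k). The deviation
   (I - 1 r) Y_k contracts by 1 - c lambda_k at each step, in a norm adapted to
   the primitive matrix W, and is forced by lambda_k O(1 + gamma_k / lambda_k),
   so it is O(1 + sup_{l <= k} gamma_l / lambda_l). Dividing by Gamma_k, the
   gain assumptions give Y_{k+1} / Gamma_k --> 1 r, and kappa_i is the ratio of
   the row sum to n times the diagonal entry. *)

Require Import Defs.
From HB Require Import structures.
From mathcomp Require Import all_boot all_order all_algebra.
From mathcomp Require Import all_classical all_reals all_analysis.
From mathcomp Require Import ring lra.

Set Implicit Arguments.
Unset Strict Implicit.
Unset Printing Implicit Defensive.

Import Order.TTheory GRing.Theory Num.Theory.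
Import numFieldNormedType.Exports.

Local Open Scope classical_set_scope.
Local Open Scope ring_scope.

(** * Sup-norm estimates for matrices *)

Lemma mx_entry_le_norm (R : realType) (m n : nat) (A : 'M[R]_(m, n)) i j :
  `|A i j| <= `|A|.
Proof.
rewrite [leRHS]/Num.Def.normr /= mx_normrE.
by apply/bigmax_geP; right => /=; exists (i, j).
Qed.

Lemma mx_norm_le (R : realType) (m n : nat) (A : 'M[R]_(m, n)) (a : R) :
  0 <= a -> (forall i j, `|A i j| <= a) -> `|A| <= a.
Proof.
move=> a0 leAa; rewrite [leLHS]/Num.Def.normr /= mx_normrE.
by apply/bigmax_leP; split => // -[i j] _; exact: leAa.
Qed.

Lemma mx_norm_mul_nneg (R : realType) (m n p : nat) (A : 'M[R]_(m, n))
    (Z : 'M[R]_(n, p)) (a : R) :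
  0 <= a -> (forall i j, 0 <= A i j) -> (forall i, \sum_j A i j <= a) ->
  `|A *m Z| <= a * `|Z|.
Proof.
move=> a0 A0 rowA; apply: mx_norm_le => [|i k]; first by rewrite mulr_ge0.
rewrite mxE (le_trans (ler_norm_sum _ _ _))//.
apply: (@le_trans _ _ (\sum_j A i j * `|Z|)).
  apply: ler_sum => j _; rewrite normrM (ger0_norm (A0 i j)).
  by rewrite ler_wpM2l// mx_entry_le_norm.
by rewrite -mulr_suml ler_wpM2r.
Qed.

(** * Stochastic and primitive matrices: one-step contraction *)

Lemma stochastic_expr (R : realType) (n : nat) (W : 'M[R]_n) (s : nat) :
  W *m const_mx 1 = const_mx 1 :> 'cV_n ->
  W ^+ s *m const_mx 1 = const_mx 1 :> 'cV_n.
Proof.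
move=> W1; elim: s => [|s IHs]; first by rewrite expr0 mul1mx.
by rewrite exprSr -mulmxE -mulmxA W1.
Qed.

Lemma stochastic_row_sum (R : realType) (n : nat) (W : 'M[R]_n) i :
  W *m const_mx 1 = const_mx 1 :> 'cV_n -> \sum_j W i j = 1.
Proof.
move=> /matrixP/(_ i 0); rewrite !mxE => <-.
by apply: eq_bigr => j _; rewrite mxE mulr1.
Qed.

(* Doeblin minorization: [W ^+ m >= delta 1 r], and [1 r] kills [Z]. *)
Lemma primitive_contraction (R : realType) (n : nat) (W : 'M[R]_n)
    (r : 'rV[R]_n) :
  primitive_mx W -> W *m const_mx 1 = const_mx 1 :> 'cV_n ->
  (forall i, 0 < r 0 i) -> \sum_(i < n) r 0 i = 1 ->
  exists m delta, [/\ (0 < m)%N, 0 < delta, delta <= 1 &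
    forall p (Z : 'M[R]_(n, p)), r *m Z = 0 ->
      `|W ^+ m *m Z| <= (1 - delta) * `|Z| ].
Proof.
move=> [_ [m m0 Wm0]] W1 r0 rsum.
(* Taking 1 as the initial value of the minimum caps [delta] at 1, so [1 - delta] is a legitimate
   contraction factor. *)
pose delta := \big[Order.min/1]_(ij : 'I_n * 'I_n) (W ^+ m) ij.1 ij.2.
have d0 : 0 < delta by apply: lt_bigmin.
have d1 : delta <= 1 by exact: bigmin_le_id.
exists m, delta; split => // p Z rZ0.
have -> : W ^+ m *m Z = (W ^+ m - delta *: (const_mx 1 *m r)) *m Z.
  by rewrite mulmxBl -scalemxAl -mulmxA rZ0 mulmx0 scaler0 subr0.
apply: mx_norm_mul_nneg => [|i j|i]; first by rewrite subr_ge0.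
- rewrite !mxE big_ord1 mxE mul1r subr_ge0.
  (* The entries of [r] are positive with sum 1, so each is at most 1 and
     [delta * r 0 j <= delta]. *)
  apply: (@le_trans _ _ delta).
    rewrite -[leRHS]mulr1 ler_pM2l// -rsum (bigD1 j)//= lerDl.
    by apply: sumr_ge0 => k _; exact/ltW.
  exact: (@bigmin_le _ _ _ _ (i, j)
    (fun ij : 'I_n * 'I_n => (W ^+ m) ij.1 ij.2)).
- have W1m := stochastic_row_sum i (stochastic_expr m W1).
  rewrite (eq_bigr (fun j => (W ^+ m) i j - delta * r 0 j)); last first.
    by move=> j _; rewrite !mxE big_ord1 mxE mul1r.
  by rewrite sumrB W1m -mulr_sumr rsum mulr1.
Qed.

(* The weights grow by [eta] at each step, so that a shift of [u] gains a
   fraction [eta / 2] of every term, the last one excepted. *)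
Lemma weighted_shift_contraction (R : realType) (m : nat) (delta : R)
    (u : nat -> R) (eta := delta / m.+1%:R) :
  0 < delta -> delta <= 1 -> (forall s, 0 <= u s) ->
  u m.+1 <= (1 - delta) * u 0%N ->
  \sum_(s < m.+1) (1 + s%:R * eta) * u s.+1 <=
  (1 - eta / 2) * \sum_(s < m.+1) (1 + s%:R * eta) * u s.
Proof.
move=> d0 d1 u0 um.
have mS0 : (0 : R) < m.+1%:R by rewrite ltr0n.
have e0 : 0 < eta by rewrite divr_gt0.
have mE : m.+1%:R * eta = delta by rewrite mulrC divfK// gt_eqF.
clearbody eta.
have mE' : m%:R * eta = delta - eta by rewrite -mE -natr1; ring.
have ed : eta <= delta by rewrite -subr_ge0 -mE' mulr_ge0// ltW.
(* The last term on the left is paired with the first on the right, where [um] applies; the other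
   terms are paired by equal argument of [u]. *)
rewrite big_ord_recr big_ord_recl /= mul0r addr0 mul1r mulrDr addrC.
apply: lerD.
  rewrite mE'; apply: (le_trans (ler_wpM2l _ um)); first lra.
  rewrite mulrA ler_wpM2r//; nra.
rewrite mulr_sumr; apply: ler_sum => s _.
rewrite /bump /= add1n mulrA ler_wpM2r// -[s.+1%:R]natr1.
have : s.+1%:R * eta <= m.+1%:R * eta.
  by rewrite ler_wpM2r ?(ltW e0)// ler_nat ltnS ltnW.
rewrite mE -natr1 => sd.
(* This product and the next add up to [eta * (1 - (s + 1) * eta)], twice the slack between the two
   coefficients. *)
have : 0 <= eta * (1 + delta - (1 + (s%:R + 1) * eta)).
  by rewrite mulr_ge0//; lra.
have : 0 <= eta * (1 - delta) by rewrite mulr_ge0//; lra.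
lra.
Qed.

(** The sup norm contracts only under a power of [W], while the recursion applies [W] once per step.
    Summing the norms along the orbit [W ^+ s *m Z] with slowly increasing weights yields an
    equivalent norm that contracts under [W] itself. *)
Lemma primitive_adapted_norm (R : realType) (n : nat) (W : 'M[R]_n)
    (r : 'rV[R]_n) (p : nat) :
  primitive_mx W -> W *m const_mx 1 = const_mx 1 :> 'cV_n ->
  (forall i, 0 < r 0 i) -> \sum_(i < n) r 0 i = 1 ->
  exists (N : 'M[R]_(n, p) -> R) (a c : R), [/\ 0 <= a, 0 < c, c <= 1,
    (forall Z, `|Z| <= N Z <= a * `|Z|) &
    [/\ forall Z Z', N (Z + Z') <= N Z + N Z',
        forall t Z, N (t *: Z) = `|t| * N Z &
        forall Z, r *m Z = 0 -> N (W *m Z) <= (1 - c) * N Z] ].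
Proof.
move=> Wprim W1 r0 rsum.
have W0 := Wprim.1.
have [m' [delta [m0 d0 d1]]] := primitive_contraction Wprim W1 r0 rsum.
case: m' m0 => // m _ contr.
pose eta := delta / m.+1%:R.
have e0 : 0 < eta by rewrite divr_gt0// ltr0n.
have ed : eta <= delta by rewrite ler_pdivrMr ?ltr0n// ler_peMr ?ler1n// ltW.
have w0 s : 0 <= 1 + s%:R * eta by rewrite addr_ge0// mulr_ge0// ltW.
have Ws1 s (Z : 'M[R]_(n, p)) : `|W ^+ s *m Z| <= `|Z|.
  elim: s => [|s IHs]; first by rewrite expr0 mul1mx.
  rewrite exprS -mulmxE -mulmxA (le_trans _ IHs)//.
  rewrite -[leRHS]mul1r; apply: mx_norm_mul_nneg => // i.
  by rewrite (stochastic_row_sum i W1).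
exists (fun Z => \sum_(s < m.+1) (1 + s%:R * eta) * `|W ^+ s *m Z|).
(* No power of [W] expands the sup norm, so the total weight is the upper constant; the term [s = 0]
   alone gives the lower bound. *)
exists (\sum_(s < m.+1) (1 + s%:R * eta)), (eta / 2).
split; [exact: sumr_ge0|by rewrite divr_gt0|lra| |split].
- move=> Z; apply/andP; split.
    rewrite big_ord_recl /= mul0r addr0 mul1r expr0 mul1mx lerDl.
    by apply: sumr_ge0 => s _; rewrite mulr_ge0.
  by rewrite mulr_suml; apply: ler_sum => s _; rewrite ler_wpM2l.
- move=> Z Z'; rewrite -big_split; apply: ler_sum => s _ /=.
  by rewrite -mulrDr ler_wpM2l// mulmxDr ler_normD.
- move=> t Z; rewrite mulr_sumr; apply: eq_bigr => s _.
  by rewrite -scalemxAr normrZ mulrCA.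
- move=> Z rZ0.
  have shift : forall s : nat, W ^+ s *m (W *m Z) = W ^+ s.+1 *m Z.
    by move=> s; rewrite exprSr -mulmxE mulmxA.
  under eq_bigr do rewrite shift.
  apply: (@weighted_shift_contraction _ m delta (fun s => `|W ^+ s *m Z|)) => //.
  by rewrite expr0 mul1mx contr.
Qed.

(** [B / c] is the fixed point of each affine step whatever [lambda l] is, so [x 0 + B / c] is
    preserved as an upper bound, uniformly in [k]. *)
Lemma gain_recursion_bound (R : realType) (x lambda : nat -> R) (c B : R)
    (k : nat) :
  0 < c -> c <= 1 -> (forall l, 0 < lambda l <= 1) -> 0 <= x 0%N -> 0 <= B ->
  (forall l, (l < k)%N ->
    x l.+1 <= (1 - c * lambda l) * x l + lambda l * B) ->
  x k <= x 0%N + B / c.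
Proof.
move=> c0 c1 lam x0 B0; elim: k => [_|k IHk rec].
  by rewrite lerDl divr_ge0// ltW.
have {}IHk : x k <= x 0%N + B / c.
  by apply: IHk => l lk; apply: rec; exact: ltnW.
apply: (le_trans (rec k _)) => //.
have /andP[l0 l1] := lam k.
have cl : 0 <= 1 - c * lambda k by rewrite subr_ge0 mulr_ile1// ltW.
apply: (@le_trans _ _ ((1 - c * lambda k) * (x 0%N + B / c) + lambda k * B)).
  by rewrite lerD2r ler_wpM2l.
have -> : (1 - c * lambda k) * (x 0%N + B / c) + lambda k * B =
  x 0%N + B / c - c * lambda k * x 0%N by field; rewrite gt_eqF.
by rewrite lerBlDr lerDl !mulr_ge0// ltW.
Qed.

(** * The recursion in matrix form: average and deviation *)

Section recursion_matrix.
Variables (R : realType) (n : nat) (W : 'M[R]_n) (lambda gamma : nat -> R).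
Variables (e : 'I_n -> nat -> 'rV[R]_n).

Definition est_mx k : 'M[R]_n :=
  \matrix_(i, j) eigvec_est W lambda gamma e k i 0 j.

Definition noise_mx k : 'M[R]_n := \matrix_(i, j) e i k 0 j.

Lemma est_mx0 : est_mx 0 = 1%:M.
Proof. by apply/matrixP => i j; rewrite !mxE eqxx eq_sym. Qed.

Lemma est_mxS k :
  est_mx k.+1 = (1 - lambda k) *: est_mx k
    + lambda k *: (W *m est_mx k + noise_mx k) + gamma k *: 1%:M.
Proof.
apply/matrixP => i j; rewrite !mxE eqxx /= summxE (eq_sym j).
by congr (_ + _ * (_ + _) + _); apply: eq_bigr => l _; rewrite !mxE.
Qed.

(** Since [r *m W = r], the mixing term restores the weight removed by [1 - lambda k], and
    [r *m est_mx k] simply accumulates its increments. *)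
Lemma left_mul_est_mx (r : 'rV[R]_n) k : r *m W = r ->
  r *m est_mx k = (1 + \sum_(0 <= t < k) gamma t) *: r
    + \sum_(0 <= t < k) lambda t *: (r *m noise_mx t).
Proof.
move=> rW; elim: k => [|k IHk].
  by rewrite est_mx0 mulmx1 !big_geq// !addr0 scale1r.
rewrite est_mxS !mulmxDr -!scalemxAr mulmxDr mulmxA rW mulmx1 scalerDr addrA.
rewrite -scalerDl subrK scale1r IHk !big_nat_recr//= (addrA 1) [in RHS]scalerDl.
by rewrite -!addrA; congr (_ + _); rewrite [RHS]addrC -addrA.
Qed.

Hypothesis lambda_in : forall k, 0 < lambda k <= 1.
Hypothesis gamma_gt0 : forall k, 0 < gamma k.
Variable b : R.
Hypothesis noise_le : forall k, `|noise_mx k| <= b.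

Lemma left_noise_le (r : 'rV[R]_n) k : (forall i, 0 < r 0 i) ->
  \sum_(i < n) r 0 i = 1 -> `|r *m noise_mx k| <= b.
Proof.
move=> r0 rsum; rewrite (le_trans _ (noise_le k))// -[leRHS]mul1r.
apply: mx_norm_mul_nneg => // [i j|i]; rewrite ord1; first exact: ltW.
by rewrite rsum.
Qed.

(* The deviation [D Y] obeys the same recursion, where [D = I - 1 r], with
   forcing term [lambda k * (D E + (gamma k / lambda k) D)]. *)
Lemma deviation_le (r : 'rV[R]_n) :
  primitive_mx W -> W *m const_mx 1 = const_mx 1 :> 'cV_n ->
  (forall i, 0 < r 0 i) -> r *m W = r -> \sum_(i < n) r 0 i = 1 ->
  exists2 C, 0 <= C & forall k B, 0 <= B ->
    (forall l, (l < k)%N -> gamma l / lambda l <= B) ->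
    `|est_mx k - const_mx 1 *m (r *m est_mx k)| <= C * (1 + B).
Proof.
move=> Wprim W1 r0 rW rsum.
have [N [a [c [a0 c0 c1 Nnorm [ND NZ Ncontr]]]]] :=
  primitive_adapted_norm n Wprim W1 r0 rsum.
have N0 Z : 0 <= N Z by case/andP: (Nnorm Z) => + _; exact: le_trans.
(* [D] is the projection along the constant vectors onto the kernel of [r]; it commutes with [W],
   and its image is where [N] contracts. *)
pose D : 'M[R]_n := 1%:M - const_mx 1 *m r.
have r1 : r *m (const_mx 1 : 'cV_n) = 1%:M.
  apply/matrixP => i j; rewrite !mxE ord1 (ord1 j) eqxx -[RHS]rsum.
  by apply: eq_bigr => k _; rewrite mxE mulr1.
have rD Z : r *m (D *m Z) = 0 :> 'rV_n.
  by rewrite mulmxA mulmxBr mulmx1 mulmxA r1 mul1mx subrr mul0mx.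
have DW Z : D *m (W *m Z) = W *m (D *m Z).
  rewrite mulmxA mulmxBl mul1mx -mulmxA rW.
  by rewrite [RHS]mulmxA mulmxBr mulmx1 mulmxA W1.
have b0 : 0 <= b by apply: le_trans (noise_le 0).
have DE k : `|D *m noise_mx k| <= b + b.
  rewrite mulmxBl mul1mx -mulmxA (le_trans (ler_normB _ _))// lerD//.
  rewrite (le_trans _ (left_noise_le k r0 rsum))// -[leRHS]mul1r.
  by apply: mx_norm_mul_nneg => // [i j|i]; rewrite ?mxE// big_ord1 mxE.
pose x k := N (D *m est_mx k).
have x0 k : 0 <= x k by exact: N0.
(* The bound obtained below is affine in [B]; this sum of its two coefficients times [1 + B]
   dominates it. *)
exists (x 0%N + a * (b + b + `|D|) / c).
  by rewrite addr_ge0// !(divr_ge0, mulr_ge0, addr_ge0)// ltW.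
move=> k B B0 leB.
have -> : est_mx k - const_mx 1 *m (r *m est_mx k) = D *m est_mx k.
  by rewrite mulmxBl mul1mx mulmxA.
have /andP[/le_trans-> //] := Nnorm (D *m est_mx k).
apply: (@le_trans _ _ (x 0%N + a * (b + b + B * `|D|) / c)).
  apply: gain_recursion_bound => // [|l lk].
    by rewrite !(mulr_ge0, addr_ge0).
  have /andP[l0 l1] := lambda_in l.
  pose F := D *m noise_mx l + (gamma l / lambda l) *: D.
  have -> : x l.+1 = N ((1 - lambda l) *: (D *m est_mx l)
      + (lambda l *: (W *m (D *m est_mx l)) + lambda l *: F)).
    congr N; rewrite est_mxS !mulmxDr -!scalemxAr mulmxDr mulmx1 DW.
    rewrite scalerDr -!addrA; congr (_ + (_ + _)).
    by rewrite /F [in RHS]scalerDr scalerA [lambda l * _]mulrC divfK// gt_eqF.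
  have FB : N F <= a * (b + b + B * `|D|).
    have /andP[_ /le_trans->//] := Nnorm F.
    rewrite ler_wpM2l// (le_trans (ler_normD _ _))// lerD//.
    by rewrite normrZ ler_wpM2r// ger0_norm ?leB// divr_ge0// ltW.
  apply: (le_trans (ND _ _)).
  rewrite NZ ger0_norm ?subr_ge0//.
  (* The factor splits as [(1 - lambda l) + lambda l * (1 - c)]: the retained estimate, with
     nonnegative weight as [lambda l <= 1], and the mixed one contracted by [W]. *)
  have -> : (1 - c * lambda l) * x l + lambda l * (a * (b + b + B * `|D|)) =
    (1 - lambda l) * x l +
    (lambda l * ((1 - c) * x l) + lambda l * (a * (b + b + B * `|D|))) by ring.
  rewrite lerD2l (le_trans (ND _ _))// !NZ (gtr0_norm l0).
  by apply: lerD; rewrite ler_pM2l//; apply: Ncontr; exact: rD.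
have -> : (x 0%N + a * (b + b + `|D|) / c) * (1 + B) =
  x 0%N + a * (b + b + B * `|D|) / c
  + (x 0%N * B + a * (B * (b + b) + `|D|) / c) by ring.
by rewrite lerDl !(divr_ge0, mulr_ge0, addr_ge0)// ltW.
Qed.

End recursion_matrix.

(** * Limits along one path of bounded noise *)

Section limits.
Variables (R : realType) (n : nat) (W : 'M[R]_n) (r : 'rV[R]_n).
Variables (lambda gamma : nat -> R) (e : 'I_n -> nat -> 'rV[R]_n) (b : R).
Hypotheses (W_primitive : primitive_mx W)
  (W_stochastic : W *m const_mx 1 = const_mx 1 :> 'cV[R]_n)
  (r_gt0 : forall i, 0 < r 0 i) (r_left : r *m W = r)
  (r_sum : \sum_(i < n) r 0 i = 1)
  (gamma_gt0 : forall k, 0 < gamma k) (lambda_in : forall k, 0 < lambda k <= 1)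
  (gamma_div : (\sum_(0 <= t < k.+1) gamma t) @[k --> \oo] --> +oo)
  (ratio_sup :
    (sup [set gamma l / lambda l | l in [set l : nat | (l <= k)%N]]
       / \sum_(0 <= t < k.+1) gamma t) @[k --> \oo] --> (0 : R))
  (ratio_sum :
    ((\sum_(0 <= t < k.+1) lambda t) / (\sum_(0 <= t < k.+1) gamma t))
       @[k --> \oo] --> (0 : R))
  (noise_le : forall i k j, `|e i k 0 j| <= b).

Let Gamma k := \sum_(0 <= t < k.+1) gamma t.
Let Lambda k := \sum_(0 <= t < k.+1) lambda t.
Let S k := sup [set gamma l / lambda l | l in [set l : nat | (l <= k)%N]].

Let Gamma_gt0 k : 0 < Gamma k.
Proof.
rewrite /Gamma big_nat_recr//= ltr_wpDl// sumr_ge0// => t _; exact: ltW.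
Qed.

Let ratio_le_sup k l : (l <= k)%N -> gamma l / lambda l <= S k.
Proof.
move=> lk; apply: ub_le_sup; last by exists l.
(* [sup] bounds its set only if that set is bounded above; the sum of the finitely many nonnegative
   ratios is such a bound. *)
exists (\sum_(0 <= t < k.+1) gamma t / lambda t) => _ [t /= tk <-].
rewrite big_mkord (bigD1 (Ordinal (tk : (t < k.+1)%N)))//= lerDl.
apply: sumr_ge0 => s _; have /andP[l0 _] := lambda_in s.
by rewrite divr_ge0// ltW.
Qed.

Let S_ge0 k : 0 <= S k.
Proof.
apply: le_trans (ratio_le_sup (leq0n k)); have /andP[l0 _] := lambda_in 0.
by rewrite divr_ge0// ltW.
Qed.

Lemma eigvec_est_cvg i j :
  eigvec_est W lambda gamma e k.+1 i 0 j / Gamma k @[k --> \oo] --> r 0 j.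
Proof.
have b0 : 0 <= b by apply: le_trans (noise_le i 0 i).
have E_le k : `|noise_mx e k| <= b.
  by apply: mx_norm_le => // p q; rewrite mxE.
have [C C0 devC] := deviation_le lambda_in gamma_gt0 E_le W_primitive
  W_stochastic r_gt0 r_left r_sum.
(* The three terms collect the constants (from the deviation and the initial estimate), the gain
   ratios in the deviation, and the accumulated averaged noise. *)
pose bnd k := (C + `|r|) * (Gamma k)^-1 + C * (S k / Gamma k)
  + b * (Lambda k / Gamma k).
have bnd0 : bnd k @[k --> \oo] --> (0 : R).
  rewrite [X in _ --> X](_ : _ = (C + `|r|) * 0 + C * 0 + b * 0); last by ring.
  apply: cvgD; last exact: cvgMl_tmp.
  apply: cvgD; last exact: cvgMl_tmp.
  apply: cvgMl_tmp; apply/gtr0_cvgV0 => //.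
  by near=> k.
apply/subr_cvg0/cvgr0Pnorm_le => eps eps_gt0; near=> k.
apply: (@le_trans _ _ (bnd k)); last first.
  rewrite (le_trans (ler_norm _))//.
  by near: k; exact: cvgr0_norm_le.
set Y := est_mx W lambda gamma e k.+1.
have -> : eigvec_est W lambda gamma e k.+1 i 0 j = Y i j by rewrite [RHS]mxE.
(* Removing [Gamma k *: r] from [r *m Y] leaves [r], from the initial condition, and the noise
   sum. *)
have YE : Y i j / Gamma k - r 0 j =
    ((Y - const_mx 1 *m (r *m Y)) i j
     + (r + \sum_(0 <= t < k.+1) lambda t *: (r *m noise_mx e t)) 0 j)
    / Gamma k.
  rewrite [in RHS]left_mul_est_mx// -/(Gamma k).
  set s := \sum_(_ <= _ < _) _.
  rewrite !mxE big_ord1 !mxE; field; exact: lt0r_neq0.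
rewrite YE normrM [`|(Gamma k)^-1|]gtr0_norm ?invr_gt0//.
have -> : bnd k = (C * (1 + S k) + (`|r| + Lambda k * b)) / Gamma k.
  by rewrite /bnd; field; exact: lt0r_neq0.
rewrite ler_pM2r ?invr_gt0// (le_trans (ler_normD _ _))// lerD//.
  rewrite (le_trans (mx_entry_le_norm _ _ _))// devC ?S_ge0// => l.
  by rewrite ltnS => /ratio_le_sup.
rewrite (le_trans (mx_entry_le_norm _ _ _))// (le_trans (ler_normD _ _))//.
rewrite lerD2l (le_trans (ler_norm_sum _ _ _))// mulr_suml.
apply: ler_sum => t _; have /andP[l0 _] := lambda_in t.
by rewrite normrZ (gtr0_norm l0) ler_pM2l// (left_noise_le E_le).
Unshelve. all: by end_near. Qed.

(** The diagonal estimate grows like [r 0 i * Gamma k] and eventually exceeds [epsk]; from then on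
    the gain is the quotient, in which the normalization by [Gamma k] cancels. *)
Lemma scaling_gain_cvg epsk i : (n > 0)%N ->
  scaling_gain W lambda gamma epsk e k i @[k --> \oo] --> (n%:R * r 0 i)^-1.
Proof.
move=> n0.
pose y k j : R := eigvec_est W lambda gamma e k.+1 i 0 j.
have yk : (\sum_(j < n) y k j / Gamma k) / (n%:R * (y k i / Gamma k))
    @[k --> \oo] --> (n%:R * r 0 i)^-1.
  have -> : (n%:R * r 0 i)^-1 = (\sum_(j < n) r 0 j) * (n%:R * r 0 i)^-1.
    by rewrite r_sum mul1r.
  apply: cvgM.
    by apply: (cvg_big (@add_continuous R^o)) => j _; exact: eigvec_est_cvg.
  apply: cvgV; first by rewrite mulf_neq0 ?pnatr_eq0 -?lt0n// lt0r_neq0.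
  by apply: cvgMl_tmp; exact: eigvec_est_cvg.
apply: cvg_trans yk; apply: near_eq_cvg; near=> k.
have yi : epsk < y k i.
  (* Half the positive limit is an eventual lower bound, and the divergence of [Gamma k] lifts it
     past [epsk]. *)
  have ri : r 0 i / 2 < y k i / Gamma k.
    near: k; apply: (cvgr_gt _ (@eigvec_est_cvg i i) (r 0 i / 2)).
    by rewrite ltr_pdivrMr// ltr_pMr// ltr1n.
  have Gk : epsk / (r 0 i / 2) < Gamma k.
    by near: k; move/cvgryPgt: gamma_div; apply.
  have r2 : 0 < r 0 i / 2 by rewrite divr_gt0.
  rewrite ltr_pdivrMr// in Gk; rewrite ltr_pdivlMr// in ri.
  by apply: lt_trans ri; rewrite mulrC.
have -> : scaling_gain W lambda gamma epsk e k i =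
    (\sum_(j < n) y k j) / (n%:R * y k i).
  by rewrite /y in yi *; case: (k) yi => [|k'] /= ->.
rewrite -mulr_suml [n%:R * (_ / _)]mulrA invfM invrK mulrACA mulVf ?mulr1//.
exact: lt0r_neq0.
Unshelve. all: by end_near. Qed.

End limits.

(** * From the Euclidean noise bound to the almost sure limit *)

Lemma entry_le_enorm (R : realType) (n : nat) (v : 'rV[R]_n) j :
  `|v 0 j| <= enorm v.
Proof.
rewrite -sqrtr_sqr ler_wsqrtr// (bigD1 j)//= lerDl.
by apply: sumr_ge0 => i _; exact: sqr_ge0.
Qed.

Theorem lemma3
  (R : realType) (n : nat)
  (* communication digraph ([E j i]: j is an in-neighbor of i), weights *)
  (E : rel 'I_n) (W : 'M[R]_n)
  (W_in : forall i j, (j == i) || E j i -> 0 < W i j < 1)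
  (W_out : forall i j, ~~ ((j == i) || E j i) -> W i j = 0)
  (W_primitive : primitive_mx W)
  (W_stochastic : W *m const_mx 1 = const_mx 1 :> 'cV[R]_n)
  (* left Perron vector *)
  (r : 'rV[R]_n)
  (r_gt0 : forall i, 0 < r 0 i)
  (r_left : r *m W = r)
  (r_sum : \sum_(i < n) r 0 i = 1)
  (* gains *)
  (lambda gamma : nat -> R) (epsk : R)
  (epsk_gt0 : 0 < epsk)
  (gamma_gt0 : forall k, 0 < gamma k)
  (lambda_in : forall k, 0 < lambda k <= 1)
  (lambda_noninc : nonincreasing_seq lambda)
  (lambda_div : (\sum_(0 <= t < k.+1) lambda t) @[k --> \oo] --> +oo)
  (gamma_div : (\sum_(0 <= t < k.+1) gamma t) @[k --> \oo] --> +oo)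
  (ratio_sup :
    (sup [set gamma l / lambda l | l in [set l : nat | (l <= k)%N]]
       / \sum_(0 <= t < k.+1) gamma t) @[k --> \oo] --> (0 : R))
  (ratio_sum :
    ((\sum_(0 <= t < k.+1) lambda t) / (\sum_(0 <= t < k.+1) gamma t))
       @[k --> \oo] --> (0 : R))
  (* noise *)
  (d : measure_display) (T : measurableType d) (P : probability T R)
  (e : 'I_n -> nat -> T -> 'rV[R]_n)
  (e_meas : forall i k,
    measurable_fun [set: T] (e i k : T -> borel_rV R n))
  (e_indep : mutually_independent P
    (fun ik : 'I_n * nat => e ik.1 ik.2 : T -> borel_rV R n))
  (e_mean : forall i k j, ('E_P[fun w => (e i k w 0 j)%R] = 0)%E)
  (sigma : R) (sigma_gt0 : 0 < sigma)
  (e_var : forall i k, (vvariance P (e i k) <= sigma%:E)%E)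
  (sigmay : R)
  (e_bound : {ae P, forall w, forall i k, enorm (e i k w) <= sigmay}) :
  {ae P, forall w, forall i : 'I_n,
    scaling_gain W lambda gamma epsk (fun j k => e j k w) k i
      @[k --> \oo] --> (n%:R * r 0 i)^-1}.
Proof.
(* For [n = 0] the sum of the entries of [r] would be empty, hence 0 instead of 1. *)
have n0 : (0 < n)%N.
  case: n r r_sum {E W W_in W_out W_primitive W_stochastic r_gt0 r_left e e_meas
    e_indep e_mean e_var e_bound} => // r' /eqP.
  by rewrite big_ord0 eq_sym oner_eq0.
apply: filterS e_bound => w ew i.
apply: (scaling_gain_cvg (b := sigmay)) => // {}i k j.
exact: le_trans (entry_le_enorm _ _) (ew i k).
Qed.
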